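(* a) The standard form parameters ($Q_+$, $Q^+$, $\mathbb{Z}^P_k$ for $k\in\{1,2,\dots\}\cup\{\infty\}$, and $Q_-$, $Q^-$, $\mathbb{Z}^\Lambda_k$ for integers $k\ge2$) are indecomposable and pairwise non-isomorphic. Any indecomposable form parameter is isomorphic to one of them. b) Every form parameter $P$ has a maximal splitting $P\cong Q\oplus G$. Moreover, $Q$ and $G$ are each well-defined up to isomorphism (i.e. if $P\cong Q\oplus G$ and $P\cong Q'\oplus G'$ are maximal splittings then $Q\cong Q'$ and $G\cong G'$).
   Context: All abelian groups are finitely generated; $\mathbb{Z}_n=\mathbb{Z}/n$ and $\mathbb{Z}_{2^\infty}:=\mathbb{Z}$. A form parameter is a triple $Q=(Q_e,h,p)$ with $Q_e$ an abelian group and homomorphisms $h\colon Q_e\to\mathbb{Z}$, $p\colon\mathbb{Z}\to Q_e$ such that $hph=2h$, $php=2p$. A morphism $\alpha\colon P\to Q$ is a homomorphism $\alpha\colon P_e\to Q_e$ with $h_P=h_Q\circ\alpha$ and $p_Q=\alpha\circ p_P$; it is an isomorphism if $P_e\to Q_e$ is. Standard form parameters, written $Q_e\xrightarrow{h}\mathbb{Z}\xrightarrow{p}Q_e$: $Q_+=(\mathbb{Z}\xrightarrow{2}\mathbb{Z}\xrightarrow{1}\mathbb{Z})$; $\mathbb{Z}^P_k=(\mathbb{Z}\oplus\mathbb{Z}_{2^k}\to\mathbb{Z}\to\mathbb{Z}\oplus\mathbb{Z}_{2^k})$ with $h(a,b)=a$, $p(1)=(2,-1)$, for $k\in\{1,2,\dots\}\cup\{\infty\}$;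 $Q^+=(\mathbb{Z}\xrightarrow{1}\mathbb{Z}\xrightarrow{2}\mathbb{Z})$; $Q_-=(\mathbb{Z}_2\xrightarrow{0}\mathbb{Z}\xrightarrow{1}\mathbb{Z}_2)$; $\mathbb{Z}^\Lambda_k=(\mathbb{Z}_{2^k}\xrightarrow{0}\mathbb{Z}\xrightarrow{2^{k-1}}\mathbb{Z}_{2^k})$ for $k\ge2$; $Q^-=(0\to\mathbb{Z}\to0)$. For a form parameter $Q$ and abelian group $G$, the split form parameter $Q\oplus G$ is $(Q_e\oplus G,(h,0),(p,0)^t)$. A splitting of $P$ is an isomorphism $P\cong Q\oplus G$. $P$ is decomposable if it admits a splitting with $G$ non-trivial, and indecomposable otherwise. A splitting $P\cong Q\oplus G$ is maximal if $Q$ is indecomposable. *)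

(* Defs.v *)
From HB Require Import structures.
From mathcomp Require Import all_boot all_order all_algebra.

Set Implicit Arguments.
Unset Strict Implicit.
Unset Printing Implicit Defensive.

Import Order.TTheory GRing.Theory Num.Theory.
Local Open Scope ring_scope.

Definition fin_gen (G : zmodType) : Prop :=
  exists (n : nat) (g : 'I_n -> G),
    forall x : G, exists c : 'I_n -> int, x = \sum_(i < n) g i *~ c i.

Record fgAbGroup := FgAbGroup {
  fgAb_sort :> zmodType;
  fgAb_fin_gen : fin_gen fgAb_sort
}.

Definition group_iso (G H : fgAbGroup) : Prop :=
  exists f : {additive G -> H}, bijective f.

Definition nontrivial (G : fgAbGroup) : Prop := exists x : G, x != 0.

Definition inj_l (G H : zmodType) (x : G) : G * H := (x, 0).
Definition inj_r (G H : zmodType) (y : H) : G * H := (0, y).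

Fact inj_l_is_zmod_morphism (G H : zmodType) : zmod_morphism (@inj_l G H).
Proof. by move=> x y; congr pair; rewrite /= subr0. Qed.
HB.instance Definition _ (G H : zmodType) :=
  GRing.isZmodMorphism.Build G (G * H)%type (@inj_l G H)
    (@inj_l_is_zmod_morphism G H).

Fact inj_r_is_zmod_morphism (G H : zmodType) : zmod_morphism (@inj_r G H).
Proof. by move=> x y; congr pair; rewrite /= subr0. Qed.
HB.instance Definition _ (G H : zmodType) :=
  GRing.isZmodMorphism.Build H (G * H)%type (@inj_r G H)
    (@inj_r_is_zmod_morphism G H).

Lemma fin_gen_prod (G H : fgAbGroup) : fin_gen (G * H)%type.
Proof.
have [m [g hg]] := fgAb_fin_gen G; have [n [h hh]] := fgAb_fin_gen H.
exists (m + n)%N, (fun i => match split i with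
  inl j => inj_l H (g j) | inr k => inj_r G (h k) end) => -[x y].
have [c hc] := hg x; have [d hd] := hh y.
exists (fun i => match split i with inl j => c j | inr k => d k end).
rewrite big_split_ord /=.
under eq_bigr => i _ do rewrite -[lshift _ _]/(unsplit (inl i)) unsplitK -raddfMz.
under [X in _ = _ + X]eq_bigr => i _ do
  rewrite -[rshift _ _]/(unsplit (inr i)) unsplitK -raddfMz.
by rewrite -!raddf_sum -hc -hd; congr pair; rewrite /= ?addr0 ?add0r.
Qed.

Definition prodAb (G H : fgAbGroup) : fgAbGroup :=
  FgAbGroup (fin_gen_prod G H).

Lemma fin_gen_cyclic (G : zmodType) (a : G) :
  (forall x : G, exists n : int, x = a *~ n) -> fin_gen G.
Proof.
move=> ha; exists 1%N, (fun=> a) => x; have [n ->] := ha x.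
by exists (fun=> n); rewrite big_ord1.
Qed.

Lemma fin_gen_int : fin_gen int.
Proof. by apply: (@fin_gen_cyclic int 1) => x; exists x; rewrite intz. Qed.

Lemma fin_gen_Zp (n : nat) : fin_gen 'Z_n.
Proof.
by apply: (@fin_gen_cyclic 'Z_n 1) => x; exists (x : nat); rewrite -[LHS]natr_Zp.
Qed.

Lemma fin_gen_I1 : fin_gen 'I_1.
Proof.
by apply: (@fin_gen_cyclic 'I_1 0) => x; exists 0; rewrite (ord1 x).
Qed.

Definition intAb : fgAbGroup := FgAbGroup fin_gen_int.
Definition zeroAb : fgAbGroup := FgAbGroup fin_gen_I1.
(* 'Z_n is Z/n only for 1 < n. *)
Definition ZpAb (n : nat) : fgAbGroup := FgAbGroup (fin_gen_Zp n).

Record formParam := FormParam {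
  fp_e : fgAbGroup;
  fp_h : {additive fp_e -> int};
  fp_p : {additive int -> fp_e};
  fp_hph : forall x : fp_e, fp_h (fp_p (fp_h x)) = fp_h x *+ 2;
  fp_php : forall n : int, fp_p (fp_h (fp_p n)) = fp_p n *+ 2
}.

Record fp_mor (P Q : formParam) := FpMor {
  mor_fun :> {additive fp_e P -> fp_e Q};
  mor_h : forall x : fp_e P, fp_h P x = fp_h Q (mor_fun x);
  mor_p : forall n : int, fp_p Q n = mor_fun (fp_p P n)
}.

Definition fp_iso (P Q : formParam) : Prop :=
  exists alpha : fp_mor P Q, bijective alpha.

Section Split.
Variables (Q : formParam) (G : fgAbGroup).

Definition split_h : {additive prodAb (fp_e Q) G -> int} := fp_h Q \o fst.
Definition split_p : {additive int -> prodAb (fp_e Q) G} :=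
  inj_l G \o fp_p Q.

Fact split_hph x : split_h (split_p (split_h x)) = split_h x *+ 2.
Proof. exact: fp_hph. Qed.

Fact split_php n : split_p (split_h (split_p n)) = split_p n *+ 2.
Proof. by rewrite /= fp_php raddfMn. Qed.

Definition split_fp : formParam := FormParam split_hph split_php.
End Split.

Definition has_splitting (P Q : formParam) (G : fgAbGroup) : Prop :=
  fp_iso P (split_fp Q G).

Definition decomposable (P : formParam) : Prop :=
  exists (Q : formParam) (G : fgAbGroup), nontrivial G /\ has_splitting P Q G.

Definition indecomposable (P : formParam) : Prop := ~ decomposable P.

Definition has_maximal_splitting (P Q : formParam) (G : fgAbGroup) : Prop :=
  has_splitting P Q G /\ indecomposable Q.

(* In the standard form parameters p is given as intmul a : n |-> a *~ n, the
   homomorphism with p(1) = a.  The subscripted Q_+, Q_- are Q_lower_plus and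
   Q_lower_minus, the superscripted Q^+, Q^- are Q_upper_plus and
   Q_upper_minus. *)

Lemma intmul1E (n : int) : intmul (1 : int) n = n.
Proof. exact: intz. Qed.

Lemma intmul2E (n : int) : intmul (2 : int) n = n *+ 2.
Proof. by rewrite mulrzz mulr_natl. Qed.

Definition Q_lower_plus_h : {additive intAb -> int} := intmul (2 : int).
Definition Q_lower_plus_p : {additive int -> intAb} := intmul (1 : int).

Fact Q_lower_plus_hph x :
  Q_lower_plus_h (Q_lower_plus_p (Q_lower_plus_h x)) = Q_lower_plus_h x *+ 2.
Proof. by rewrite [Q_lower_plus_p _]intmul1E [LHS]intmul2E. Qed.

Fact Q_lower_plus_php n :
  Q_lower_plus_p (Q_lower_plus_h (Q_lower_plus_p n)) = Q_lower_plus_p n *+ 2.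
Proof. by rewrite [LHS]intmul1E [Q_lower_plus_p n]intmul1E [LHS]intmul2E. Qed.

Definition Q_lower_plus : formParam :=
  FormParam Q_lower_plus_hph Q_lower_plus_php.

Definition Q_upper_plus_h : {additive intAb -> int} := intmul (1 : int).
Definition Q_upper_plus_p : {additive int -> intAb} := intmul (2 : int).

Fact Q_upper_plus_hph x :
  Q_upper_plus_h (Q_upper_plus_p (Q_upper_plus_h x)) = Q_upper_plus_h x *+ 2.
Proof. by rewrite [LHS]intmul1E [Q_upper_plus_h x]intmul1E [LHS]intmul2E. Qed.

Fact Q_upper_plus_php n :
  Q_upper_plus_p (Q_upper_plus_h (Q_upper_plus_p n)) = Q_upper_plus_p n *+ 2.
Proof. by rewrite [Q_upper_plus_h _]intmul1E [LHS]intmul2E. Qed.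

Definition Q_upper_plus : formParam :=
  FormParam Q_upper_plus_hph Q_upper_plus_php.

Lemma intmul_mulr2n_eq0 (G : zmodType) (a : G) (n : int) :
  a *+ 2 = 0 -> intmul a n *+ 2 = 0.
Proof. by move=> a2; rewrite pmulrn mulrzAC -pmulrn a2 mul0rz. Qed.

Definition Q_lower_minus_h : {additive ZpAb 2 -> int} := \0.
Definition Q_lower_minus_p : {additive int -> ZpAb 2} := intmul (1 : 'Z_2).

Fact Q_lower_minus_hph x :
  Q_lower_minus_h (Q_lower_minus_p (Q_lower_minus_h x))
  = Q_lower_minus_h x *+ 2.
Proof. by rewrite [RHS]mul0rn. Qed.

Fact Q_lower_minus_php n :
  Q_lower_minus_p (Q_lower_minus_h (Q_lower_minus_p n))
  = Q_lower_minus_p n *+ 2.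
Proof. by rewrite [RHS]intmul_mulr2n_eq0 ?[LHS]raddf0 //; apply: val_inj. Qed.

Definition Q_lower_minus : formParam :=
  FormParam Q_lower_minus_hph Q_lower_minus_php.

Definition Q_upper_minus_h : {additive zeroAb -> int} := \0.
Definition Q_upper_minus_p : {additive int -> zeroAb} := \0.

Fact Q_upper_minus_hph x :
  Q_upper_minus_h (Q_upper_minus_p (Q_upper_minus_h x))
  = Q_upper_minus_h x *+ 2.
Proof. by rewrite [RHS]mul0rn. Qed.

Fact Q_upper_minus_php n :
  Q_upper_minus_p (Q_upper_minus_h (Q_upper_minus_p n))
  = Q_upper_minus_p n *+ 2.
Proof. by rewrite [RHS]mul0rn. Qed.

Definition Q_upper_minus : formParam :=
  FormParam Q_upper_minus_hph Q_upper_minus_php.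

(* Z_{2^k}, with None standing for k = infinity and Z_{2^infinity} = Z.
   Meaningful for k <> Some 0 only ('Z_1 is Z/2); std_index below excludes
   that value. *)
Definition Z2pow (k : option nat) : nzRingType :=
  if k is Some k' then 'Z_(2 ^ k') else int.

Lemma fin_gen_Z2pow (k : option nat) : fin_gen (Z2pow k).
Proof. by case: k => [k|]; [exact: fin_gen_Zp | exact: fin_gen_int]. Qed.

Definition Z2powAb (k : option nat) : fgAbGroup := FgAbGroup (fin_gen_Z2pow k).

Section ZP.
Variable k : option nat.

Definition ZP_h : {additive prodAb intAb (Z2powAb k) -> int} := fst.
Definition ZP_p : {additive int -> prodAb intAb (Z2powAb k)} :=
  intmul ((2, -1) : int * Z2pow k).

Lemma ZP_hpE n : ZP_h (ZP_p n) = n *+ 2.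
Proof. by rewrite [LHS]raddfMz; exact: intmul2E. Qed.

Fact ZP_hph x : ZP_h (ZP_p (ZP_h x)) = ZP_h x *+ 2.
Proof. exact: ZP_hpE. Qed.

Fact ZP_php n : ZP_p (ZP_h (ZP_p n)) = ZP_p n *+ 2.
Proof. by rewrite ZP_hpE raddfMn. Qed.

Definition ZP : formParam := FormParam ZP_hph ZP_php.
End ZP.

Section ZLambda.
Variables (k : nat) (k_ge2 : (2 <= k)%N).

Definition ZLambda_h : {additive ZpAb (2 ^ k) -> int} := \0.
Definition ZLambda_p : {additive int -> ZpAb (2 ^ k)} :=
  intmul ((2 ^ k.-1)%:R : 'Z_(2 ^ k)).

Fact ZLambda_hph x : ZLambda_h (ZLambda_p (ZLambda_h x)) = ZLambda_h x *+ 2.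
Proof. by rewrite [RHS]mul0rn. Qed.

Fact ZLambda_php n : ZLambda_p (ZLambda_h (ZLambda_p n)) = ZLambda_p n *+ 2.
Proof.
rewrite [RHS]intmul_mulr2n_eq0 ?[LHS]raddf0 //.
rewrite -mulrnA -expnSr prednK ?(ltnW k_ge2) // pchar_Zp //.
by rewrite -{1}(expn0 2) ltn_exp2l // (ltnW k_ge2).
Qed.

Definition ZLambda : formParam := FormParam ZLambda_hph ZLambda_php.
End ZLambda.

Inductive std_index : Type :=
  | IQ_lower_plus
  | IQ_upper_plus
  | IZP (k : nat) of (1 <= k)%N
  | IZP_infty
  | IQ_lower_minus
  | IQ_upper_minus
  | IZLambda (k : nat) of (2 <= k)%N.

Definition std_fp (i : std_index) : formParam :=
  match i with
  | IQ_lower_plus => Q_lower_plus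
  | IQ_upper_plus => Q_upper_plus
  | IZP k _ => ZP (Some k)
  | IZP_infty => ZP None
  | IQ_lower_minus => Q_lower_minus
  | IQ_upper_minus => Q_upper_minus
  | IZLambda k k_ge2 => ZLambda k_ge2
  end.

(* Main.v *)
(* Since h p h = 2 h and p h p = 2 p, either h (p 1) = 2, or h = 0 and
   2 p(1) = 0.  A parameter Q splits off P as soon as there are a morphism
   s : Q -> P and a homomorphism r : P -> Q preserving h such that r s is
   bijective; the complement is ker r.  If h has an odd value, take the least k
   such that 2^k kills 2 e - p(1) for some e with h e = 1: this gives Q^+ for
   k = 0, Z^P_k for k > 0, and Z^P_infty when there is no such k.  If h = 0 and
   p(1) <> 0, take the least k such that p(1) is not divisible by 2^k.  By
   minimality a character to Z/2^k or Z detects the relevant element, and this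
   character yields r.  In the remaining cases p(1) or 0 spans the summand.

   Conversely, every endomorphism of a standard parameter is injective, hence
   standard parameters are indecomposable, and bijective except for Z^P_infty,
   hence Q cancels from Q + G = Q + G'; for Z^P_infty one cancels Z twice.  A
   splitting gives morphisms P -> Q and Q -> P, and the numbers k above are
   invariants of P under the existence of morphisms both ways. *)

Require Import Defs.
From HB Require Import structures.
From mathcomp Require Import all_boot all_order all_algebra.
From mathcomp Require Import zify ring.
From Stdlib Require Import Classical.

Set Implicit Arguments.
Unset Strict Implicit.
Unset Printing Implicit Defensive.

Import Order.TTheory GRing.Theory Num.Theory.
Local Open Scope ring_scope.

(** * Additive maps and their kernels *)

Lemma additive_of (A B : zmodType) (f : A -> B) :
  zmod_morphism f -> exists F : {additive A -> B}, F =1 f.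
Proof.
move=> fB.
pose F : {additive A -> B} := HB.pack f (GRing.isZmodMorphism.Build A B f fB).
by exists F.
Qed.

Lemma bijective_of (A B : choiceType) (f : A -> B) :
  injective f -> (forall y, exists x, f x = y) -> bijective f.
Proof.
move=> fI fS; have fS' y : exists x, f x == y by have [x <-] := fS y; exists x.
exists (fun y => xchoose (fS' y)) => [x|y];
  last exact: (eqP (xchooseP (fS' y))).
exact: fI (eqP (xchooseP (fS' _))).
Qed.

Definition ker (A B : zmodType) (f : {additive A -> B}) : {pred A} :=
  fun x => f x == 0.

Fact ker_zmod_closed (A B : zmodType) (f : {additive A -> B}) :
  zmod_closed (ker f).
Proof.
split=> [|x y]; rewrite /ker !unfold_in ?raddf0 // => /eqP fx /eqP fy.
by rewrite raddfB /= fx fy subrr.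
Qed.

HB.instance Definition _ (A B : zmodType) (f : {additive A -> B}) :=
  GRing.isZmodClosed.Build A (ker f) (ker_zmod_closed f).

(** A type rather than a predicate, because the complement in a splitting has to be a group of its
    own. *)
Record kernel (A B : zmodType) (f : {additive A -> B}) :=
  Kernel { kernel_val :> A; _ : kernel_val \in ker f }.

HB.instance Definition _ (A B : zmodType) (f : {additive A -> B}) :=
  [isSub of kernel f for @kernel_val A B f].
HB.instance Definition _ (A B : zmodType) (f : {additive A -> B}) :=
  [Choice of kernel f by <:].
HB.instance Definition _ (A B : zmodType) (f : {additive A -> B}) :=
  [SubChoice_isSubZmodule of kernel f by <:].

(** * Cyclic decomposition of finitely generated abelian groups *)

Lemma zmod_closed_mulz (A : zmodType) (S : A -> Prop) :
  S 0 -> (forall x y, S x -> S y -> S (x - y)) ->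
  forall (x : A) (n : int), S x -> S (x *~ n).
Proof.
move=> S0 SB x n Sx; have SN y : S y -> S (- y) by rewrite -sub0r; exact: SB.
elim: n => [|n IH|n IH]; first by rewrite mulr0z.
  rewrite intS addrC mulrzDr mulr1z -[X in _ + X]opprK.
  by apply: SB => //; exact: SN.
by rewrite -addn1 PoszD opprD mulrzDr mulrN1z; apply: SB.
Qed.

(** Euclidean descent on the absolute value: a nonzero element of [S] either divides all of [S] or
    leaves a smaller nonzero remainder in [S]. *)
Lemma int_subgroup_principal (S : int -> Prop) :
  S 0 -> (forall x y, S x -> S y -> S (x - y)) ->
  exists2 d, S d & forall x, S x -> (d %| x)%Z.
Proof.
move=> S0 SB; have [[x [Sx x0]]|nS] := classic (exists x, S x /\ x != 0);
  last first.
  exists 0 => // x Sx; rewrite dvd0z; apply/negPn/negP => x0.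
  by apply: nS; exists x.
have [N] := ubnP `|x|%N; elim: N => // N IH in x Sx x0 * => ltxN.
have [|ndiv] := classic (forall y, S y -> (x %| y)%Z); first by exists x.
have [y xy] := not_all_ex_not _ _ ndiv; have {xy}[Sy xy] := imply_to_and _ _ xy.
apply: (IH (y %% x)%Z).
- rewrite /modz; apply: (SB) => //; rewrite mulrC -mulrzz.
  exact: (zmod_closed_mulz S0 SB).
- by apply/negP => /eqP xy0; apply/xy/dvdz_mod0P.
- have := ltz_mod y x0; have := modz_ge0 y x0; lia.
Qed.

(** The first coordinates of [S] form an ideal generated by some [v 0 0] with [v] in [S].
    Subtracting a multiple of [v] clears the first coordinate, and induction treats the rest. The
    rows of [M] generate but may be dependent, so a square matrix suffices. *)
Lemma int_lattice_basis n (S : 'rV[int]_n -> Prop) :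
  S 0 -> (forall x y, S x -> S y -> S (x - y)) ->
  exists M : 'M[int]_n, forall v, S v <-> exists y, v = y *m M.
Proof.
elim: n => [|n IH] in S * => S0 SB.
  exists 0 => v; rewrite [v]thinmx0; split=> // _.
  by exists 0; rewrite mul0mx.
have SZ := zmod_closed_mulz S0 SB.
have [d [v Sv dE] dvd] : exists2 d, (exists2 v, S v & d = v 0 0) &
    forall x, (exists2 v, S v & x = v 0 0) -> (d %| x)%Z.
  apply: int_subgroup_principal; first by exists 0; rewrite ?mxE.
  by move=> _ _ [v Sv ->] [w Sw ->]; exists (v - w); [exact: SB | rewrite !mxE].
have [|x y Sx Sy|M ME] := IH (fun w => S (row_mx (0 : 'M_1) w)).
- by rewrite row_mx0.
- have := SB _ _ Sx Sy.
  by rewrite (@opp_row_mx _ 1 1 n) (@add_row_mx _ 1 1 n) subr0.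
exists (col_mx v (row_mx (0 : 'M_(n, 1)) M)) => w; split=> [Sw|[y ->]].
  have /dvdzP[q wq] := dvd _ (ex_intro2 _ _ w Sw erefl).
  pose w' : 'rV[int]_n.+1 := w - v *~ q.
  have w'E : w' = row_mx (0 : 'M_1) (rsubmx (w' : 'rV_(1 + n))).
    rewrite -[LHS](@hsubmxK _ 1 1 n) (_ : lsubmx _ = 0) //; apply/rowP => i.
    have l0 : lshift n (0 : 'I_1) = 0 :> 'I_n.+1 by exact: val_inj.
    rewrite ord1 !mxE l0.
    by rewrite -scaler_int !mxE wq dE intz subrr.
  have : S w' by apply: SB => //; exact: SZ.
  rewrite w'E => /ME[y yE]; exists (row_mx (q%:M : 'M_1) y).
  rewrite (@mul_row_col _ 1 1 n) mul_scalar_mx (@mul_mx_row _ 1 n 1 n).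
  rewrite mulmx0 -yE -w'E.
  by rewrite /w' -scaler_int intz addrC subrK.
rewrite -[y](@hsubmxK _ 1 1 n) (@mul_row_col _ 1 1 n).
have SD x z : S x -> S z -> S (x + z).
  by move=> Sx Sz; rewrite -[z]opprK -[- z]sub0r; apply/SB/SB.
apply: SD.
  rewrite [lsubmx _]mx11_scalar mul_scalar_mx -[_ 0 0]intz scaler_int.
  exact: SZ.
by rewrite (@mul_mx_row _ 1 n 1 n) mulmx0; apply/ME; eexists.
Qed.

Lemma natr_Zp_eq0 (n m : nat) : (1 < n)%N ->
  (m%:R == 0 :> 'Z_n) = (n %| m)%N.
Proof. by move=> n1; rewrite -val_eqE /= val_Zp_nat. Qed.

Lemma intr_Zp_eq0 (n : nat) (z : int) : (1 < n)%N ->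
  (z%:~R == 0 :> 'Z_n) = (n %| z)%Z.
Proof.
move=> n1; case: z => m; first by rewrite -[_%:~R]/(m%:R) natr_Zp_eq0.
by rewrite NegzE mulrNz oppr_eq0 -[_%:~R]/(m.+1%:R) natr_Zp_eq0.
Qed.

Lemma hom_of_Zp (A : zmodType) (n : nat) (x : A) : (1 < n)%N -> x *+ n = 0 ->
  exists F : {additive 'Z_n -> A}, forall m : nat, F m%:R = x *+ m.
Proof.
move=> n1 xn0; have modE m : x *+ (m %% (Zp_trunc n).+2) = x *+ m.
  by rewrite Zp_cast // [in RHS](divn_eq m n) mulrnDr mulnC mulrnA xn0 mul0rn
    add0r.
have [|F FE] := @additive_of 'Z_n A (fun y : 'Z_n => x *+ y).
  move=> y z; apply: (addIr (x *+ z)); rewrite subrK -mulrnDr -[LHS]modE.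
  by rewrite -{2}[y](subrK z).
by exists F => m; rewrite FE val_Zp_nat // -[RHS]modE Zp_cast.
Qed.

(* [b] exhibits [A] as the direct sum of the cyclic groups Z/d_i, where
   [d i = 0] stands for an infinite cyclic summand. *)
Definition cyclic_basis (A : zmodType) n (b : 'I_n -> A) (d : 'I_n -> int) :=
  (forall x, exists z : 'I_n -> int, x = \sum_i b i *~ z i) /\
  (forall z : 'I_n -> int, \sum_i b i *~ z i = 0 <-> forall i, (d i %| z i)%Z).

(** The relations among the generators form a lattice. Its Smith normal form [L D R] makes them
    diagonal once the generators are transformed by [R]. *)
Lemma fin_gen_cyclic_basis (A : zmodType) : fin_gen A ->
  exists n (b : 'I_n -> A) d, cyclic_basis b d.
Proof.
move=> [n [g gen]].
pose S (v : 'rV[int]_n) := \sum_i g i *~ v 0 i = 0.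
have [||M SE] := @int_lattice_basis n S.
- by rewrite /S big1 // => i _; rewrite mxE mulr0z.
- move=> x y Sx Sy; rewrite /S; under eq_bigr do rewrite !mxE mulrzBr.
  by rewrite sumrB Sx Sy subrr.
have [L uL [R uR [d _ ME]]] := int_Smith_normal_form M.
pose b j := \sum_i g i *~ R j i.
have bE (w : 'rV[int]_n) : \sum_j b j *~ w 0 j = \sum_i g i *~ (w *m R) 0 i.
  under eq_bigr => j _ do rewrite mulrz_suml.
  rewrite exchange_big; apply: eq_bigr => i _; rewrite mxE mulrz_sumr.
  by apply: eq_bigr => j _; rewrite -mulrzA mulrC.
have rowE (z : 'I_n -> int) :
    \sum_j b j *~ z j = \sum_j b j *~ (\row_j z j) 0 j.
  by apply: eq_bigr => j _; rewrite mxE.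
(* Beyond the length of [d] the default entry 0 gives infinite cyclic summands. *)
exists n, b, (fun i => d`_i); split=> [x|z].
  have [c ->] := gen x; exists (fun j => (\row_j c j *m invmx R) 0 j).
  by rewrite bE mulmxKV //; apply: eq_bigr => i _; rewrite mxE.
rewrite rowE bE -/(S (\row_j z j *m R)) SE.
pose D : 'M[int]_n := \matrix_(i, j) (d`_i *+ (i == j :> nat)).
have DE (y : 'rV[int]_n) j : (y *m D) 0 j = y 0 j * d`_j.
  rewrite mxE (bigD1 j) //= big1 ?addr0 => [|i ij]; rewrite mxE ?eqxx //.
  by rewrite val_eqE (negPf ij) mulr0.
split=> [[y yE] j|dvd].
  have {}yE : \row_j z j = y *m L *m D.
    by rewrite -[LHS](mulmxK uR) yE ME !mulmxA mulmxK.
  move/rowP/(_ j): yE; rewrite DE mxE => ->; exact: dvdz_mull.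
have /fin_all_exists[q qE] : forall j, exists q, z j = q * d`_j.
  by move=> j; exact/dvdzP.
exists (\row_j q j *m invmx L); rewrite ME !mulmxA mulmxKV //; congr (_ *m _).
by apply/rowP => j; rewrite DE !mxE qE.
Qed.

Lemma cyclic_basis_hom (A T : zmodType) n (b : 'I_n -> A) d (f : 'I_n -> T) :
  cyclic_basis b d -> (forall i, f i *~ d i = 0) ->
  exists F : {additive A -> T},
    forall z, F (\sum_i b i *~ z i) = \sum_i f i *~ z i.
Proof.
move=> [gen rel] fd.
have ext (z w : 'I_n -> int) : \sum_i b i *~ z i = \sum_i b i *~ w i ->
    \sum_i f i *~ z i = \sum_i f i *~ w i.
  move/eqP; rewrite -subr_eq0 -sumrB; under eq_bigr do rewrite -mulrzBr.
  move/eqP/(rel (fun i => z i - w i)) => dvd; apply/eqP.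
  rewrite -subr_eq0 -sumrB big1 // => i _; rewrite -mulrzBr.
  by have /dvdzP[q ->] := dvd i; rewrite mulrC mulrzA fd mul0rz.
(* Coordinates are unique only modulo the [d i]. Finite functions form a [choiceType], so some can
   be chosen, and [ext] makes the choice harmless. *)
have ex_c x : exists z : {ffun 'I_n -> int}, x == \sum_i b i *~ z i.
  have [z ->] := gen x; exists [ffun i => z i].
  by apply/eqP/eq_bigr => i _; rewrite ffunE.
pose c x := xchoose (ex_c x).
have cE x : x = \sum_i b i *~ c x i by apply/eqP/(xchooseP (ex_c x)).
have [|F FE] := @additive_of A T (fun x => \sum_i f i *~ c x i).
  move=> x y; rewrite -sumrB; under [RHS]eq_bigr do rewrite -mulrzBr.
  apply: (ext _ (fun i => c x i - c y i)); rewrite -cE {1}(cE x) {1}(cE y).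
  by rewrite -sumrB; under eq_bigr do rewrite -mulrzBr.
by exists F => z; rewrite FE; apply: ext; rewrite -cE.
Qed.

Lemma cyclic_basis_coord (A T : zmodType) n (b : 'I_n -> A) d i (u : T) :
  cyclic_basis b d -> u *~ d i = 0 ->
  exists F : {additive A -> T}, forall z, F (\sum_i b i *~ z i) = u *~ z i.
Proof.
move=> bP ud; have [j|F FE] :=
  @cyclic_basis_hom A T n b d (fun j => if j == i then u else 0) bP.
  by case: eqP => [->|]; rewrite ?mul0rz.
exists F => z; rewrite FE (bigD1 i) //= eqxx big1 ?addr0 // => j /negPf->.
by rewrite mul0rz.
Qed.

(** If [gcdz n (d i)] divided every coordinate [z i] of [a], Bezout would make [a] divisible by [n].
    At an index where it does not, with gcd g, sending [b i] to n/g respects the relation [d i] and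
    does not kill [a]. *)
Lemma Zp_character_separates (A : zmodType) (n : nat) (a : A) :
  fin_gen A -> (1 < n)%N -> (forall x, x *+ n <> a) ->
  exists F : {additive A -> 'Z_n}, F a != 0.
Proof.
move=> /fin_gen_cyclic_basis[m [b [d bP]]] n1 na; have [gen rel] := bP.
have [z aE] := gen a.
have [i ndvd] : exists i, ~~ (gcdz n (d i) %| z i)%Z.
  apply: NNPP => all_dvd.
  have /fin_all_exists[u uE] : forall i,
      exists u : int, (d i %| z i - u * n%:Z)%Z.
    move=> i; have /dvdzP[q ->] : (gcdz n (d i) %| z i)%Z.
      by apply/negPn/negP => ndvd; apply: all_dvd; exists i.
    have [v [w <-]] := Bezoutz n (d i); exists (q * v); apply/dvdzP.
    by exists (q * w); ring.
  apply: (na (\sum_i b i *~ u i)); rewrite pmulrn mulrz_suml aE.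
  apply/esym/eqP; rewrite -subr_eq0 -sumrB.
  under eq_bigr do rewrite -mulrzA -mulrzBr.
  exact/eqP/(rel (fun i => z i - u i * n%:Z)).
set g := gcdz n (d i) in ndvd.
have /dvdzP[n' nE] : (g %| n%:Z)%Z := dvdz_gcdl _ _.
have /dvdzP[d' dE] : (g %| d i)%Z := dvdz_gcdr _ _.
have n'0 : n' != 0.
  by apply: contraTneq n1 => n'0; move: nE; rewrite n'0 mul0r; lia.
have [|F FE] := @cyclic_basis_coord A 'Z_n m b d i n'%:~R bP.
  apply/eqP; rewrite -mulrzA intr_Zp_eq0 // dE; apply/dvdzP; exists d'.
  by rewrite nE; ring.
exists F; rewrite aE FE -mulrzA intr_Zp_eq0 // nE.
by rewrite dvdz_mul2l.
Qed.

(** An odd coordinate of [t] on an infinite summand is the functional sought. If all of them are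
    even, halving them gives [x] with [t - x *+ 2] torsion, which leads to a contradiction. *)
Lemma odd_functional (A : zmodType) (t : A) :
  fin_gen A -> (forall k x, (t - x *+ 2) *+ 2 ^ k <> 0) ->
  exists F : {additive A -> int}, ~~ (2 %| F t)%Z.
Proof.
move=> /fin_gen_cyclic_basis[n [b [d bP]]] nt; have [gen rel] := bP.
have [z tE] := gen t.
have [[i [di0 zi]]|even_z] := classic (exists i, d i = 0 /\ ~~ (2 %| z i)%Z).
  have [|F FE] := @cyclic_basis_coord A int n b d i 1 bP.
    by rewrite di0 mulr0z.
  by exists F; rewrite tE FE intz.
pose m := (\prod_(i | d i != 0) `|d i|)%N.
have m0 : (0 < m)%N by apply: prodn_cond_gt0 => i; rewrite absz_gt0.
pose x := \sum_i b i *~ (if d i == 0 then (z i %/ 2)%Z else 0).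
have mx0 : (t - x *+ 2) *+ m = 0.
  rewrite !pmulrn tE mulrz_suml -sumrB mulrz_suml.
  under eq_bigr do rewrite -mulrzA -mulrzBr -mulrzA.
  apply/rel => i; case: eqP => [di0|/eqP di0]; last first.
    by rewrite mul0r subr0 dvdz_mull // dvdzE /= /m (bigD1 i) //= dvdn_mulr.
  have z2 : (2 %| z i)%Z by apply/negPn/negP => ?; apply: even_z; exists i.
  by rewrite divzK // subrr mul0r dvdz0.
have [o] := pfactor_coprime (isT : prime 2) m0.
rewrite coprime2n => o_odd mE.
(* The odd part [o] of [m] is absorbed by changing [x]: since [o] is odd, [y *+ o] is again [t]
   minus a double. *)
set y := t - x *+ 2 in mx0; case: (nt (logn 2 m) (x - y *+ o./2)).
have -> : t - (x - y *+ o./2) *+ 2 = y *+ o.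
  rewrite -[in RHS](odd_double_half o) o_odd mulrnDr mulr1n -muln2 mulrnA.
  by rewrite mulrnBl opprB addrA addrAC.
by rewrite -mulrnA -mE.
Qed.

(** * Cancellation of direct summands *)

Lemma int_functional_factor (A : zmodType) (F : {additive A -> int}) (d : int) :
  d != 0 -> (forall x, (d %| F x)%Z) ->
  exists F' : {additive A -> int}, forall x, F x = d * F' x.
Proof.
move=> d0 dvd; have divE x : F x = d * (F x %/ d)%Z by rewrite mulrC divzK.
have [|F' F'E] := @additive_of A int (fun x => (F x %/ d)%Z).
  by move=> x y; apply: (mulfI d0); rewrite mulrBr -!divE raddfB.
by exists F' => x; rewrite F'E.
Qed.

Lemma int_functional_surjective (A : zmodType) (F : {additive A -> int}) x :
  F x != 0 -> exists d (F' : {additive A -> int}),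
    [/\ d != 0, forall y, F y = d * F' y & exists e, F' e = 1].
Proof.
move=> Fx0.
have [d [e Fe] dvd] : exists2 d, (exists e, F e = d) &
    forall z, (exists y, F y = z) -> (d %| z)%Z.
  apply: int_subgroup_principal; first by exists 0; rewrite raddf0.
  by move=> _ _ [y <-] [z <-]; exists (y - z); rewrite raddfB.
have d0 : d != 0.
  by apply: contraNneq Fx0 => d0; rewrite -dvd0z -d0; apply: dvd; exists x.
have [|F' F'E] := int_functional_factor (F := F) d0.
  by move=> y; apply: dvd; exists y.
exists d, F'; split=> //; exists e; apply: (mulfI d0).
by rewrite -F'E mulr1.
Qed.

Lemma additive_inverse (A B : zmodType) (f : {additive A -> B}) :
  bijective f -> exists2 g : {additive B -> A}, cancel f g & cancel g f.
Proof.
move=> [g fK gK]; have [|G GE] := @additive_of B A g.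
  by move=> x y; apply: (can_inj fK); rewrite raddfB !gK.
by exists G => x; rewrite GE.
Qed.

(** The isomorphism is the [G'] to [G] block of the inverse of [phi]. For surjectivity, the
    bijective [C] block lets [c] be chosen so that [phi (c, g)] has first component 0. *)
Lemma split_cancel_bijective_component (C G G' : zmodType)
    (phi : {additive C * G -> C * G'}) :
  bijective phi -> bijective (fun c => (phi (c, 0)).1) ->
  exists f : {additive G' -> G}, bijective f.
Proof.
move=> phiB [a aK Ka]; have [psi phiK psiK] := additive_inverse phiB.
exists (snd \o psi \o @inj_r C G'); apply: bijective_of => [|g].
  apply: raddf_inj => g' /= psi2; move: (psiK (0, g')) psi2.
  case: (psi _) => c g /= phi_cg g0; move: phi_cg; rewrite {}g0 => phi_c.
  have c0 : c = 0.
    by rewrite -[c]aK phi_c /= -[RHS]aK -[(0, 0)]/(0 : C * G) raddf0.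
  by move: phi_c; rewrite c0 -[(0, 0)]/(0 : C * G) raddf0 => -[].
pose c := - a (phi (0, g)).1.
have cg : (c, g) = (c, 0) + (0, g) by congr pair; rewrite /= ?addr0 ?add0r.
exists (phi (c, g)).2 => /=.
rewrite (_ : inj_r C _ = phi (c, g)) ?phiK //.
rewrite [RHS]surjective_pairing; congr pair.
have cN : (c, 0) = - (- c, 0) :> C * G by congr pair; rewrite /= ?opprK ?oppr0.
by rewrite cg raddfD /= cN raddfN /= opprK Ka addNr.
Qed.

(** If [b] or [b'] vanishes, the integer block of [phi] or [psi] is onto, hence bijective, and the
    previous lemma applies. Otherwise both groups split off an infinite cyclic summand with
    corresponding kernels. *)
Lemma split_cancel_int (G G' : zmodType)
    (phi : {additive int * G -> int * G'}) :
  bijective phi -> exists f : {additive G -> G'}, bijective f.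
Proof.
move=> phiB; have [psi phiK psiK] := additive_inverse phiB.
have surj_bij (f : {additive int -> int}) n : f n = 1 -> bijective f.
  move=> fn; have fE m : f m = f 1 * m by rewrite -{1}[m]intz raddfMz mulrzz.
  have f1 : f 1 * f 1 = 1.
    have : f 1 * n = 1 by rewrite -fE.
    move=> f1n; have : f 1 \is a GRing.unit.
      by apply/unitrP; exists n; rewrite mulrC.
    by rewrite qualifE => /= /orP[] /eqP ->.
  by exists f => m; rewrite (fE m) (fE (f 1 * m)) mulrA f1 mul1r.
pose b : {additive G -> int} := fst \o phi \o @inj_r int G.
pose b' : {additive G' -> int} := fst \o psi \o @inj_r int G'.
have pairE (H : zmodType) c (g : H) : (c, g) = inj_l H c + inj_r int g.
  by congr pair; rewrite /= ?addr0 ?add0r.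
have [[g0 bg0]|b0] := classic (exists g, b g != 0); last first.
  have {}b0 g : b g = 0 by apply/eqP/negPn/negP => ?; apply: b0; exists g.
  have [|f /additive_inverse[f' fK f'K]] :=
    split_cancel_bijective_component phiB; last by exists f', f.
  case E: (psi (1, 0)) => [c g].
  apply: (surj_bij (fst \o phi \o @inj_l int G) c) => /=.
  have := psiK (1, 0); rewrite E pairE raddfD => /(congr1 fst) /=.
  by rewrite -[(phi (inj_r _ _)).1]/(b g) b0 addr0.
have [[g0' bg0']|b0] := classic (exists g, b' g != 0); last first.
  have {}b0 g : b' g = 0 by apply/eqP/negPn/negP => ?; apply: b0; exists g.
  apply: (@split_cancel_bijective_component int G' G psi).
    by exists phi.
  case E: (phi (1, 0)) => [c g].
  apply: (surj_bij (fst \o psi \o @inj_l int G') c) => /=.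
  have := phiK (1, 0); rewrite E pairE raddfD => /(congr1 fst) /=.
  by rewrite -[(psi (inj_r _ _)).1]/(b' g) b0 addr0.
have [d [c [d0 bE [e ce]]]] := int_functional_surjective bg0.
have [d' [c' [d'0 b'E [e' ce']]]] := int_functional_surjective bg0'.
(* G = ker c + Z e, G' = ker c' + Z e', and phi maps ker c onto ker c'. *)
have exch (H H' : zmodType) (f : {additive int * H -> int * H'})
    (k : {additive H -> int}) (x : H) (y : H') :
  exists F : {additive H -> H'}, forall h,
    F h = (f (0, h - x *~ k h)).2 + y *~ k h.
  apply: additive_of => g h; rewrite raddfB !mulrzBr.
  rewrite (_ : (0, _) = (0, g - x *~ k g) - (0, h - x *~ k h)).
    by rewrite raddfB /= opprD addrACA.
  by congr pair; rewrite /= ?subr0 // opprB opprD opprK addrACA [- h + _]addrC.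
have [F FE] := exch _ _ phi c e e'; have [F' F'E] := exch _ _ psi c' e' e.
(* Stated symmetrically, to serve for both cancellations. That [f] carries ker [k] into ker [k']
   follows by applying [f'] back: the first component returns to 0, and [d2] is nonzero. *)
have inv (H H' : zmodType) (f : {additive int * H -> int * H'})
    (f' : {additive int * H' -> int * H}) (k : {additive H -> int})
    (k' : {additive H' -> int}) x y d1 d2 :
    cancel f f' -> d2 != 0 -> k x = 1 -> k' y = 1 ->
    (forall h, (f (0, h)).1 = d1 * k h) ->
    (forall h, (f' (0, h)).1 = d2 * k' h) ->
  forall F1 F2,
    (forall h, F1 h = (f (0, h - x *~ k h)).2 + y *~ k h) ->
    (forall h, F2 h = (f' (0, h - y *~ k' h)).2 + x *~ k' h) ->
  cancel F1 F2.
  move=> fK d20 kx k'y fE f'E F1 F2 F1E F2E h.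
  have f0 : (f (0, h - x *~ k h)).1 = 0.
    by rewrite fE raddfB raddfMz /= kx intz subrr mulr0.
  have f0E : f (0, h - x *~ k h) = (0, (f (0, h - x *~ k h)).2).
    by rewrite [LHS]surjective_pairing f0.
  have k0 : k' (f (0, h - x *~ k h)).2 = 0.
    by apply: (mulfI d20); rewrite -f'E -f0E fK mulr0.
  have kF1 : k' (F1 h) = k h.
    by rewrite F1E raddfD k0 [k' (y *~ _)]raddfMz k'y add0r intz.
  by rewrite F2E kF1 F1E addrK -f0E fK subrK.
exists F, F'; first exact: (inv _ _ phi psi c c' e e' d d').
exact: (inv _ _ psi phi c' c e' e d' d).
Qed.

Lemma fin_gen_surjective (A B : zmodType) (f : {additive A -> B}) :
  fin_gen A -> (forall y, exists x, f x = y) -> fin_gen B.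
Proof.
move=> [n [g gen]] surj; exists n, (f \o g) => y; have [x <-] := surj y.
have [c ->] := gen x; exists c; rewrite raddf_sum.
by apply: eq_bigr => i _; rewrite raddfMz.
Qed.

(** * Morphisms and splittings of form parameters *)

Lemma fp_pE (P : formParam) n : fp_p P n = fp_p P 1 *~ n.
Proof. by rewrite -raddfMz intz. Qed.

Lemma fp_mor_of (P Q : formParam) (f : {additive fp_e P -> fp_e Q}) :
  (forall x, fp_h P x = fp_h Q (f x)) -> f (fp_p P 1) = fp_p Q 1 ->
  exists m : fp_mor P Q, m =1 f.
Proof.
move=> fh fp; have fp' n : fp_p Q n = f (fp_p P n).
  by rewrite (fp_pE P) raddfMz fp -fp_pE.
by exists (FpMor fh fp').
Qed.

Lemma fp_iso_sym (P Q : formParam) : fp_iso P Q -> fp_iso Q P.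
Proof.
move=> [f /[dup] fB /additive_inverse[g fK gK]].
have [x||m mE] := @fp_mor_of Q P g; first by rewrite (mor_h f) gK.
  by rewrite (mor_p f) fK.
by exists m, f => x; rewrite mE ?gK ?fK.
Qed.

Lemma fp_iso_trans (P Q R : formParam) :
  fp_iso P Q -> fp_iso Q R -> fp_iso P R.
Proof.
move=> [f fB] [g gB].
have [x||m mE] := @fp_mor_of P R (g \o f : {additive _ -> _}).
- by rewrite (mor_h f) (mor_h g).
- by rewrite /= -mor_p -mor_p.
by exists m; apply: (eq_bij (bij_comp gB fB)) => x; rewrite mE.
Qed.

Lemma split_fp_iso (Q Q' : formParam) (G : fgAbGroup) :
  fp_iso Q Q' -> fp_iso (split_fp Q G) (split_fp Q' G).
Proof.
move=> [f [g fK gK]].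
have [|F FE] := @additive_of (fp_e Q * G)%type (fp_e Q' * G)%type
  (fun x => (f x.1, x.2)).
  by move=> x y; rewrite /= raddfB.
have [x||m mE] := @fp_mor_of (split_fp Q G) (split_fp Q' G) F.
- by rewrite /= FE (mor_h f).
- by rewrite FE /= -mor_p.
exists m, (fun x => (g x.1, x.2)) => -[x y]; rewrite mE FE /= ?fK ?gK //.
Qed.

Lemma split_fp_trivial (Q : formParam) (G : fgAbGroup) :
  ~ nontrivial G -> fp_iso (split_fp Q G) Q.
Proof.
move=> G0; have {}G0 (g : G) : g = 0.
  by apply/eqP/negPn/negP => g0; apply: G0; exists g.
have [x||m mE] := @fp_mor_of (split_fp Q G) Q (fst : {additive _ -> _}) => //.
by exists m, (inj_l G) => x; rewrite mE //=; case: x => x g; rewrite (G0 g).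
Qed.

(** With [t] inverse to [r \o s], the map [s \o t \o r] is a projector with kernel ker [r]. There h
    vanishes because [r] preserves it, while p(1) lies in the image of [s]. *)
Lemma splitting_of_retraction (P Q : formParam)
    (s : {additive fp_e Q -> fp_e P}) (r : {additive fp_e P -> fp_e Q}) :
  (forall x, fp_h Q x = fp_h P (s x)) -> s (fp_p Q 1) = fp_p P 1 ->
  (forall x, fp_h P x = fp_h Q (r x)) -> bijective (r \o s) ->
  exists G, has_splitting P Q G.
Proof.
move=> sh sp rh /[dup] /additive_inverse[t rsK rtK] _.
have projP x : x - s (t (r x)) \in ker r.
  by rewrite unfold_in raddfB /= [r (s _)]rtK subrr.
have [|proj projE] := @additive_of _ (kernel r) (fun x => Kernel (projP x)).
  move=> x y; apply: val_inj; rewrite [RHS]raddfB.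
  rewrite -[LHS]/(x - y - s (t (r (x - y)))) -[RHS]/(x - _ - (y - _)).
  by rewrite !raddfB addrACA.
have projK (y : kernel r) : proj (val y) = y.
  apply: val_inj; rewrite projE /=; case: y => y /= /eqP ->.
  by rewrite !raddf0 addr0.
have fgG : fin_gen (kernel r).
  apply: (fin_gen_surjective (f := proj) (fgAb_fin_gen (fp_e P))) => y.
  by exists (val y).
exists (FgAbGroup fgG); apply: fp_iso_sym.
have [|F FE] := @additive_of (fp_e Q * kernel r)%type (fp_e P)
  (fun x => s x.1 + val x.2).
  by move=> x y; rewrite /= !raddfB addrACA opprD.
have rF x : r (F x) = r (s x.1).
  by rewrite FE raddfD /=; case: x => x [y /= /eqP ->]; rewrite addr0.
have [x||m mE] := @fp_mor_of (split_fp Q (FgAbGroup fgG)) P F.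
- by rewrite rh rF -rh -sh.
- by rewrite FE /= addr0.
exists m; exists (fun x => (t (r x), proj x)) => x; rewrite mE.
  case: x (rF x) => x y /= ->; rewrite [t _]rsK FE raddfD /= projK.
  congr pair; rewrite -[RHS]add0r; congr (_ + _); apply: val_inj.
  by rewrite projE /= [t _]rsK subrr.
by rewrite FE /= projE /= addrC subrK.
Qed.

(** * Endomorphisms of the standard form parameters *)

Lemma pow2_gt1 k : (0 < k)%N -> (1 < 2 ^ k)%N.
Proof. by move=> k0; rewrite -{1}(expn0 2) ltn_exp2l. Qed.

Lemma pow2_pred_neq0 k : (0 < k)%N -> (2 ^ k.-1)%:R != 0 :> 'Z_(2 ^ k).
Proof.
move=> k0; rewrite natr_Zp_eq0 ?pow2_gt1 //.
by rewrite dvdn_Pexp2l // -ltnNge prednK.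
Qed.

(** [f] is multiplication by [f 1]. An even [f 1] would kill the element of order two, so [f 1] is
    odd, hence a unit. *)
Lemma Zpow2_endo_bijective k (f : {additive 'Z_(2 ^ k) -> 'Z_(2 ^ k)}) :
  (0 < k)%N -> f (2 ^ k.-1)%:R != 0 -> bijective f.
Proof.
move=> k0; have n1 := pow2_gt1 k0.
have fE y : f y = f 1 * y by rewrite -{1 2}[y]natr_Zp raddfMn mulr_natr.
rewrite fE => f_neq0; have u : f 1 \is a GRing.unit.
  rewrite -[f 1]natr_Zp unitZpE // coprimeXl // coprime2n.
  apply: contraNT f_neq0; rewrite -dvdn2 => /dvdnP[q qE].
  rewrite -[f 1]natr_Zp qE -natrM -mulnA -expnS prednK // natrM.
  by rewrite pchar_Zp ?mulr0.
exists (fun y => (f 1)^-1 * y) => y; first by rewrite (fE y) mulKr.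
by rewrite (fE (_ * y)) mulVKr.
Qed.

Lemma int_Zpow2_endo_bijective k
    (f : {additive int * 'Z_(2 ^ k) -> int * 'Z_(2 ^ k)}) :
  (0 < k)%N -> (forall x, (f x).1 = x.1) -> (f (0, (2 ^ k.-1)%:R)).2 != 0 ->
  bijective f.
Proof.
move=> k0 f1 f2.
pose g : {additive 'Z_(2 ^ k) -> 'Z_(2 ^ k)} := snd \o f \o @inj_r int _.
have [g' gK g'K] := Zpow2_endo_bijective (f := g) k0 f2.
apply: bijective_of => [|[m y]].
  apply: raddf_inj => -[m y] fmy.
  have m0 : m = 0 by rewrite -[m]/((m, y).1) -f1 fmy.
  rewrite {}m0 in fmy *; suff -> : y = 0 by [].
  by apply: (can_inj gK); rewrite raddf0 /= fmy.
pose z := g' (y - (f (m, 0)).2); exists (m, z).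
rewrite [LHS]surjective_pairing f1; congr pair.
rewrite (_ : (m, z) = (m, 0) + inj_r int z); last first.
  by congr pair; rewrite /= ?addr0 ?add0r.
rewrite raddfD /= -[X in _ + X]/(g z) g'K addrC subrK //.
Qed.

(** Obtained by applying [f] to p(1) = 2(1, 0) - (0, 1). The second summand is thus multiplied by
    something odd: a unit modulo [2 ^ k], and a nonzero integer in the infinite case. *)
Lemma ZP_endo_snd k (f : fp_mor (ZP k) (ZP k)) :
  (f (0, 1)).2 = (f (1, 0)).2 *+ 2 + 1.
Proof.
have := congr1 snd (mor_p f 1); rewrite /= mulr1z /=.
rewrite (_ : (2, -1) = (1, 0) *+ 2 - (0, 1) :> (int * Z2pow k)%type);
  last first.
  by congr pair; rewrite /= ?subr0 // addr0 sub0r.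
rewrite raddfB raddfMn => fp.
have {fp} : -1 = (f (1, 0)).2 *+ 2 - (f (0, 1)).2 := fp.
by move/eqP; rewrite eq_sym subr_eq addrC => /eqP ->; rewrite subrK.
Qed.

(** For [Q_lower_plus] and [Q_upper_plus], h is injective, so [f] is the identity; for
    [Q_lower_minus] and [ZLambda], [f] fixes the nonzero element p(1) of order two. [IZP_infty] is
    excluded since multiplication by an odd integer need not be onto. *)
Lemma std_endo_bijective i (f : fp_mor (std_fp i) (std_fp i)) :
  i <> IZP_infty -> bijective f.
Proof.
case: i f => [||k k1||||k k2] f // _.
- have fE x : f x = x.
    have := mor_h f x; rewrite [LHS]mulrzz [RHS]mulrzz.
    by move/(mulfI (isT : 2 != 0 :> int)).
  by exists id.
- have fE x : f x = x.
    by have := mor_h f x; rewrite [LHS]intmul1E [RHS]intmul1E.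
  by exists id.
- apply: (int_Zpow2_endo_bijective k1) => [x|].
    by rewrite -[LHS](mor_h f).
  have -> : (0, (2 ^ k.-1)%:R) = (0, 1) *+ (2 ^ k.-1)
      :> (int * 'Z_(2 ^ k))%type.
    by rewrite [RHS]surjective_pairing !raddfMn /= mul0rn.
  rewrite raddfMn [_.2]raddfMn /=.
  rewrite (ZP_endo_snd f) mulrnDl -mulrnA -expnS prednK //.
  rewrite -[X in X *+ 2 ^ k]mulr1 -mulrnAr pchar_Zp ?pow2_gt1 // mulr0 add0r.
  exact: pow2_pred_neq0.
- apply: (@Zpow2_endo_bijective 1 f) => //.
  by rewrite -[f _]/(f (fp_p Q_lower_minus 1)) -mor_p.
- by exists id => x; rewrite [LHS]ord1 [RHS]ord1.
- apply: (Zpow2_endo_bijective (ltnW k2)).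
  rewrite -[(2 ^ k.-1)%:R]mulr1z -[f _]/(f (fp_p (ZLambda k2) 1)) -mor_p.
  exact: pow2_pred_neq0 (ltnW k2).
Qed.

Lemma std_endo_injective i (f : fp_mor (std_fp i) (std_fp i)) : injective f.
Proof.
have [iE|] := classic (i = IZP_infty); last first.
  by move=> ni; exact/bij_inj/std_endo_bijective.
rewrite {}iE in f *; apply: raddf_inj => -[m y] fmy.
have m0 : m = 0 := etrans (mor_h f (m, y)) (congr1 fst fmy).
rewrite {}m0 in fmy *; have f0y : f (0, y) = f (0, 1) *~ y.
  rewrite -raddfMz; congr (f _); rewrite [RHS]surjective_pairing !raddfMz /=.
  by rewrite mul0rz intz.
have := congr1 snd fmy; rewrite f0y [LHS]raddfMz /= (ZP_endo_snd f) => /eqP.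
rewrite mulrzz mulf_eq0 => /orP[|/eqP -> //].
by move/eqP => E; exfalso; move: (_.2) E => s; lia.
Qed.

(** Projecting away the summand [G] gives an endomorphism, as h vanishes on [G] and p misses it.
    Being injective, it forces [G] to be trivial. *)
Lemma std_indecomposable i : indecomposable (std_fp i).
Proof.
move=> [Q [G [[g g0] [f /[dup] fB /additive_inverse[f' fK f'K]]]]].
have [|pr prE] := @additive_of (fp_e (std_fp i)) _ (fun x => f' ((f x).1, 0)).
  move=> x y; rewrite -raddfB; congr (f' _).
  by rewrite raddfB; congr pair; rewrite /= ?subr0.
have [x||m mE] := @fp_mor_of (std_fp i) (std_fp i) pr.
- by rewrite prE !(mor_h f) f'K.
- by rewrite prE -mor_p /= -[RHS]fK -mor_p.
have := @std_endo_injective i m (f' (0, g)) 0.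
rewrite raddf0 mE prE f'K -[(_, 0)]/(0 : fp_e Q * G) raddf0 => /(_ erefl).
move/(congr1 f); rewrite f'K raddf0 => /(congr1 snd) /= g0'.
by rewrite g0' eqxx in g0.
Qed.

(** * Existence of standard splittings *)

Lemma fp_hp2 (P : formParam) x : fp_h P x != 0 -> fp_h P (fp_p P 1) = 2.
Proof.
move=> hx; apply: (mulfI hx); rewrite mulrC -mulrzz -raddfMz -fp_pE fp_hph.
by rewrite mulr_natr.
Qed.

Lemma fp_p2 (P : formParam) : (forall x, fp_h P x = 0) -> fp_p P 1 *+ 2 = 0.
Proof. by move=> h0; rewrite -fp_php h0 raddf0. Qed.

Lemma split_upper_plus (P : formParam) e :
  fp_h P e = 1 -> e *+ 2 = fp_p P 1 -> exists G, has_splitting P Q_upper_plus G.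
Proof.
move=> he pe.
apply: (@splitting_of_retraction P Q_upper_plus (intmul e) (fp_h P)).
- by move=> n; rewrite [LHS]intmul1E raddfMz he intz.
- exact: pe.
- by move=> x; rewrite [RHS]intmul1E.
- by exists id => n /=; rewrite raddfMz he intz.
Qed.

Lemma split_lower_plus (P : formParam) x :
  fp_h P x != 0 -> (forall x, (2 %| fp_h P x)%Z) ->
  exists G, has_splitting P Q_lower_plus G.
Proof.
move=> /fp_hp2 ha h2.
have [r rE] := int_functional_factor (isT : 2 != 0 :> int) h2.
apply: (@splitting_of_retraction P Q_lower_plus (intmul (fp_p P 1)) r).
- by move=> n; rewrite raddfMz ha.
- by [].
- by move=> y; rewrite [RHS]mulrzz.
- have ra : r (fp_p P 1) = 1.
    by apply: (mulfI (isT : 2 != 0 :> int)); rewrite -rE.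
  by exists id => n /=; rewrite raddfMz ra intz.
Qed.

Lemma split_upper_minus (P : formParam) :
  (forall x, fp_h P x = 0) -> fp_p P 1 = 0 ->
  exists G, has_splitting P Q_upper_minus G.
Proof.
move=> h0 pa.
apply: (@splitting_of_retraction P Q_upper_minus \0 \0) => //.
by exists id => x; rewrite [LHS]ord1 [RHS]ord1.
Qed.

(** The summand is spanned by [e] and [t]. If [t *+ 2 ^ k.-1] were [x *+ 2 ^ k], then [e - x] would
    contradict minimality, so a character detects it; paired with h, this is the retraction. *)
Lemma split_ZP (P : formParam) k e : (0 < k)%N -> fp_h P e = 1 ->
  (e *+ 2 - fp_p P 1) *+ 2 ^ k = 0 ->
  (forall e', fp_h P e' = 1 -> (e' *+ 2 - fp_p P 1) *+ 2 ^ k.-1 <> 0) ->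
  exists G, has_splitting P (ZP (Some k)) G.
Proof.
move=> k0 he; set t := e *+ 2 - _ => tk kmin.
have ha : fp_h P (fp_p P 1) = 2 by apply: (@fp_hp2 P e); rewrite he.
have ht : fp_h P t = 0 by rewrite raddfB raddfMn /= he ha.
have [x xt|r r_neq0] := Zp_character_separates
  (fgAb_fin_gen (fp_e P)) (pow2_gt1 k0) (a := t *+ 2 ^ k.-1).
  have hx : fp_h P x = 0.
    have := congr1 (fp_h P) xt; rewrite !raddfMn /= ht mul0rn => /eqP.
    by rewrite mulrn_eq0 expn_eq0 /= => /eqP.
  apply: (kmin (e - x)); first by rewrite raddfB /= hx subr0.
  have -> : (e - x) *+ 2 - fp_p P 1 = t - x *+ 2 by rewrite mulrnBl addrAC.
  by rewrite mulrnBl -mulrnA -expnS prednK // xt subrr.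
have [F FE] := hom_of_Zp (pow2_gt1 k0) tk.
have hF y : fp_h P (F y) = 0 by rewrite -[y]natr_Zp FE raddfMn /= ht mul0rn.
have [|s sE] := @additive_of (int * 'Z_(2 ^ k))%type (fp_e P)
  (fun x => e *~ x.1 + F x.2).
  by move=> x y; rewrite /= mulrzBr raddfB opprD addrACA.
have [|q qE] := @additive_of (fp_e P) (int * 'Z_(2 ^ k))%type
  (fun x => (fp_h P x, r x)).
  by move=> x y; rewrite !raddfB.
have hs x : fp_h P (s x) = x.1.
  by rewrite sE raddfD raddfMz /= he hF intz addr0.
apply: (@splitting_of_retraction P (ZP (Some k)) s q).
- by move=> x; rewrite hs.
- rewrite -[fp_p _ 1]/((2, -1) : int * 'Z_(2 ^ k)) sE /= raddfN.
  by rewrite [F 1](FE 1%N) opprB addrC subrK.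
- by move=> x; rewrite qE.
- apply: (@int_Zpow2_endo_bijective _ (q \o s)) => // [x|] /=;
    rewrite qE /= ?hs //.
  by rewrite sE /= mulr0z add0r FE.
Qed.

Lemma split_ZP_infty (P : formParam) e : fp_h P e = 1 ->
  (forall k e', fp_h P e' = 1 -> (e' *+ 2 - fp_p P 1) *+ 2 ^ k <> 0) ->
  exists G, has_splitting P (ZP None) G.
Proof.
move=> he no_k.
have ha : fp_h P (fp_p P 1) = 2 by apply: (@fp_hp2 P e); rewrite he.
pose t := e *+ 2 - fp_p P 1.
have ht : fp_h P t = 0 by rewrite raddfB raddfMn /= he ha.
have [k x xt|r0 r0t] := odd_functional (t := t) (fgAb_fin_gen (fp_e P)).
  have hx : fp_h P x = 0.
    have := congr1 (fp_h P) xt; rewrite raddfMn raddfB raddfMn /= ht raddf0.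
    by move/eqP; rewrite mulrn_eq0 expn_eq0 sub0r oppr_eq0 mulrn_eq0 => /eqP.
  apply: (no_k k (e - x)); first by rewrite raddfB /= hx subr0.
  by rewrite -[RHS]xt; congr (_ *+ _); rewrite mulrnBl addrAC.
(* Normalise the functional: make it vanish at [e], then divide it to be onto. Its value at [t]
   stays odd. *)
have [|r1 r1E] := @additive_of _ int (fun x => r0 (x - e *~ fp_h P x)).
  move=> x y; rewrite -raddfB; congr (r0 _).
  by rewrite [fp_h P _]raddfB mulrzBr !opprD !opprK addrACA.
have r1t : r1 t = r0 t by rewrite r1E ht mulr0z subr0.
have [|d [r [d0 rE [x1 rx1]]]] := @int_functional_surjective _ r1 t.
  by rewrite r1t; apply: contraNneq r0t => ->.
have re : r e = 0.
  by apply: (mulfI d0); rewrite -rE r1E he mulr1z subrr raddf0 mulr0.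
pose x := x1 - e *~ fp_h P x1.
have hx : fp_h P x = 0 by rewrite raddfB raddfMz /= he intz subrr.
have rx : r x = 1 by rewrite raddfB raddfMz /= re mul0rz subr0.
have [q rt] : exists q, r t = q * 2 + 1.
  have : ~~ (2 %| r t)%Z.
    by apply: contra r0t; rewrite -r1t rE; apply: dvdz_mull.
  by exists (r t %/ 2)%Z; lia.
have ra : r (fp_p P 1) = - r t.
  by rewrite raddfB raddfMn /= re mul0rn sub0r opprK.
(* Moving [e] by [x *~ q] lowers the value 2q + 1 of [r] at [t] to 1, so that (h, [r]) is triangular
   on [e'] and [t']. *)
pose e' := e - x *~ q; pose t' := e' *+ 2 - fp_p P 1.
have he' : fp_h P e' = 1 by rewrite raddfB raddfMz /= hx mul0rz subr0.
have ht' : fp_h P t' = 0 by rewrite raddfB raddfMn /= he' ha.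
have re' : r e' = - q by rewrite raddfB raddfMz /= re rx intz sub0r.
have rt' : r t' = 1 by rewrite raddfB raddfMn /= re' ra rt opprK; lia.
have [|s sE] := @additive_of (int * int)%type (fp_e P)
  (fun x => e' *~ x.1 + t' *~ x.2).
  by move=> y z; rewrite /= !mulrzBr opprD addrACA.
have [|f fE] := @additive_of (fp_e P) (int * int)%type
  (fun x => (fp_h P x, r x)).
  by move=> y z; rewrite !raddfB.
have hs y : fp_h P (s y) = y.1.
  by rewrite sE raddfD !raddfMz /= he' ht' intz mul0rz addr0.
have rs y : r (s y) = y.2 - q * y.1.
  by rewrite sE raddfD !raddfMz /= re' rt' intz mulrzz mulNr addrC.
apply: (@splitting_of_retraction P (ZP None) s f).
- by move=> y; rewrite hs.
- rewrite -[fp_p _ 1]/((2, -1) : int * int) sE /= mulrN1z opprB.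
  by rewrite addrC subrK.
- by move=> y; rewrite fE.
- exists (fun y : int * int => (y.1, y.2 + q * y.1)) => -[m n] /=.
    by rewrite fE hs rs /= subrK.
  by rewrite fE hs rs /= addrK.
Qed.

Lemma cyclic_split_Zpow2 (A : zmodType) (a b : A) k : fin_gen A -> (0 < k)%N ->
  a *+ 2 = 0 -> b *+ 2 ^ k.-1 = a -> (forall x, x *+ 2 ^ k <> a) ->
  exists (s : {additive 'Z_(2 ^ k) -> A}) (r : {additive A -> 'Z_(2 ^ k)}),
    s (2 ^ k.-1)%:R = a /\ bijective (r \o s).
Proof.
move=> fgA k0 a2 ba na.
have [|s sE] := @hom_of_Zp A (2 ^ k) b (pow2_gt1 k0).
  by rewrite -(prednK k0) expnSr mulrnA ba.
have [r ra] := Zp_character_separates fgA (pow2_gt1 k0) na.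
have sa : s (2 ^ k.-1)%:R = a by rewrite sE.
exists s, r; split=> //.
by apply: (@Zpow2_endo_bijective k (r \o s)) => //=; rewrite sa.
Qed.

(** Suppose every power of 2 divides [a]. As [d i] divides [z i * 2], the coordinate is 0 when [d i]
    is 0; otherwise the odd part of [d i] divides it, and so does the 2-part, taking k to be its
    exponent. Hence [a] is 0. *)
Lemma not_pow2_divisible (A : zmodType) (a : A) : fin_gen A ->
  a *+ 2 = 0 -> a <> 0 -> exists k, forall x, x *+ 2 ^ k <> a.
Proof.
move=> /fin_gen_cyclic_basis[n [b [d [gen rel]]]] a2 a0; apply: NNPP => nk.
have {}nk k : exists x, x *+ 2 ^ k = a.
  by apply: NNPP => nx; apply: nk; exists k => x xa; apply: nx; exists x.
have [z aE] := gen a; apply: a0; rewrite aE; apply/rel => i.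
have dz2 : (d i %| z i * 2)%Z.
  apply: (proj1 (rel (fun i => z i * 2)) _ i).
  rewrite -[RHS]a2 aE pmulrn mulrz_suml.
  by under eq_bigr do rewrite mulrzA.
have [di0|di0] := eqVneq (d i) 0.
  by move: dz2; rewrite di0 !dvd0z mulf_eq0 orbF.
have [o] : exists2 o, odd o & `|d i|%N = (o * 2 ^ logn 2 `|d i|)%N.
  have di0' : (0 < `|d i|)%N by rewrite absz_gt0.
  have [o] := pfactor_coprime (isT : prime 2) di0'.
  by rewrite coprime2n; exists o.
set k := logn _ _ => o_odd dE.
have [x xa] := nk k; have [w xE] := gen x.
have dvd_wz : (d i %| w i * (2 ^ k)%N - z i)%Z.
  apply: (proj1 (rel (fun i => w i * (2 ^ k)%N - z i)) _ i).
  under eq_bigr do rewrite mulrzBr mulrzA.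
  by rewrite sumrB -mulrz_suml -xE -pmulrn xa aE subrr.
rewrite dvdzE dE Gauss_dvd ?coprimeXr ?coprimen2 //; apply/andP; split.
  have : (o %| `|z i| * 2)%N.
    by move: dz2; rewrite dvdzE abszM dE; apply: dvdn_trans; apply: dvdn_mulr.
  by rewrite Gauss_dvdl // coprimen2.
have d2 : ((2 ^ k)%N %| d i)%Z by rewrite dvdzE dE /= dvdn_mull.
have := dvdz_trans d2 dvd_wz; by rewrite rpredBl ?dvdz_mull.
Qed.

Lemma ex_min_nat (S : nat -> Prop) : (exists k, S k) ->
  exists k, S k /\ forall j, (j < k)%N -> ~ S j.
Proof.
move=> [k Sk]; apply: NNPP => nmin.
have: forall m j, (j < m)%N -> ~ S j.
  elim=> // m IH j; rewrite ltnS leq_eqVlt => /orP[/eqP -> Sm|/IH //].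
  by apply: nmin; exists m.
by move/(_ k.+1 k (ltnSn k)).
Qed.

Lemma std_splitting (P : formParam) :
  exists i G, has_splitting P (std_fp i) G.
Proof.
have [[x hx]|h0] := classic (exists x, fp_h P x != 0).
  have ha := fp_hp2 hx.
  have [[y hy]|even_h] := classic (exists y, ~~ (2 %| fp_h P y)%Z); last first.
    exists IQ_lower_plus; apply: (split_lower_plus hx) => y.
    by apply/negPn/negP => hy; apply: even_h; exists y.
  have [e he] : exists e, fp_h P e = 1.
    (* Since h(p(1)) = 2, a multiple of p(1) reduces the odd value to 1. *)
    exists (y - fp_p P 1 *~ (fp_h P y %/ 2)%Z).
    by rewrite raddfB raddfMz /= ha mulrzz; move: (fp_h P y) hy => z; lia.
  have [exT|noT] := classic (exists k e',
      fp_h P e' = 1 /\ (e' *+ 2 - fp_p P 1) *+ 2 ^ k = 0); last first.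
    exists IZP_infty; apply: (split_ZP_infty he) => k e' he' E.
    by apply: noT; exists k, e'.
  have [[|k] [[e' [he' te']] kmin]] := ex_min_nat exT.
    exists IQ_upper_plus; apply: (split_upper_plus he').
    exact: subr0_eq te'.
  exists (@IZP k.+1 isT); apply: (split_ZP _ he' te') => // e2 he2 te2.
  by apply: (kmin k) => //; exists e2.
have {}h0 x : fp_h P x = 0 by apply/eqP/negPn/negP => hx; apply: h0; exists x.
have [a0|a0] := classic (fp_p P 1 = 0).
  exists IQ_upper_minus; exact: split_upper_minus.
have a2 := fp_p2 h0.
have [k [nk kmin]] := ex_min_nat
  (not_pow2_divisible (fgAb_fin_gen (fp_e P)) a2 a0).
have k0 : (0 < k)%N by case: k nk {kmin} => // /(_ (fp_p P 1)).
have [b ba] : exists b, b *+ 2 ^ k.-1 = fp_p P 1.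
  apply: NNPP => nb; apply: (kmin k.-1); first by rewrite prednK.
  by move=> x xa; apply: nb; exists x.
have [s [r [sa rs]]] :=
  cyclic_split_Zpow2 (fgAb_fin_gen (fp_e P)) k0 a2 ba nk.
(* The case k = 1 is [Q_lower_minus], where p(1) = 1 is [2 ^ k.-1]. *)
case: k => [|[|k]] // in k0 s r sa rs {nk kmin ba} *.
- exists IQ_lower_minus.
  apply: (@splitting_of_retraction P Q_lower_minus s r) => // x; exact: h0.
- exists (@IZLambda k.+2 isT).
  by apply: (@splitting_of_retraction P (ZLambda _) s r) => // x; exact: h0.
Qed.

Lemma indecomposable_std (P : formParam) :
  indecomposable P -> exists i, fp_iso P (std_fp i).
Proof.
move=> indP; have [i [G PG]] := std_splitting P; exists i.
apply: (fp_iso_trans PG); apply: split_fp_trivial => ntG.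
by apply: indP; exists (std_fp i), G.
Qed.

(** * Invariants and uniqueness *)

Definition has_odd_h (P : formParam) : Prop := exists x, fp_h P x = 1.

Definition odd_torsion (P : formParam) k : Prop :=
  exists e, fp_h P e = 1 /\ (e *+ 2 - fp_p P 1) *+ 2 ^ k = 0.

Definition p_divisible (P : formParam) k : Prop :=
  (forall x, fp_h P x = 0) /\ exists x, x *+ 2 ^ k = fp_p P 1.

Lemma has_odd_h_mor (P Q : formParam) (f : fp_mor P Q) :
  has_odd_h P -> has_odd_h Q.
Proof. by move=> [x hx]; exists (f x); rewrite -mor_h. Qed.

Lemma odd_torsion_mor (P Q : formParam) (f : fp_mor P Q) k :
  odd_torsion P k -> odd_torsion Q k.
Proof.
move=> [e [he te]]; exists (f e); rewrite -mor_h he (mor_p f).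
by rewrite -raddfMn -raddfB -raddfMn te raddf0.
Qed.

(** Divisibility is pushed forward along [f], whereas vanishing of h is pulled back along [g]. *)
Lemma p_divisible_mor (P Q : formParam) (f : fp_mor P Q) (g : fp_mor Q P) k :
  p_divisible P k -> p_divisible Q k.
Proof.
move=> [h0 [x xa]]; split=> [y|]; first by rewrite (mor_h g).
by exists (f x); rewrite (mor_p f) -xa raddfMn.
Qed.

Lemma has_odd_h_std i : has_odd_h (std_fp i) <->
  match i with IQ_upper_plus | IZP _ _ | IZP_infty => true | _ => false end.
Proof.
case: i => [||k k1||||k k2]; split=> //.
- by move=> [x]; rewrite [LHS]mulrzz; lia.
- by exists (1 : int).
- by exists ((1, 0) : int * 'Z_(2 ^ k)).
- by exists ((1, 0) : int * int).
- by move=> [].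
- by move=> [].
- by move=> [].
Qed.

(** In [ZP] the second coordinate of 2e - p(1) is 2y + 1. Being odd, it is killed by [2 ^ k] modulo
    [2 ^ l] exactly when [l <= k], and never over the integers. *)
Lemma odd_torsion_std i k : odd_torsion (std_fp i) k <->
  match i with IQ_upper_plus => true | IZP l _ => (l <= k)%N | _ => false end.
Proof.
case: i => [||l l1||||l l2]; split=> //.
- by move=> [x []]; rewrite [LHS]mulrzz; lia.
- by exists (1 : int); split=> //; rewrite [X in X *+ _]subrr mul0rn.
- move=> [[m y] [/= m1 /(congr1 snd)]].
  rewrite raddfMn raddfB raddfMn /= opprK -[y]natr_Zp -mulrnA -[1]/(1%:R).
  rewrite -natrD -mulrnA => /eqP; rewrite natr_Zp_eq0 ?pow2_gt1 //.
  rewrite Gauss_dvdr ?coprimeXl ?coprime2n ?addn1 /= ?muln2 ?odd_double //.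
  by rewrite dvdn_Pexp2l.
- move=> lk; exists ((1, 0) : int * 'Z_(2 ^ l)); split=> //.
  rewrite (_ : _ - _ = (0, 1)); last first.
    by congr pair; rewrite /= ?add0r ?opprK.
  rewrite [LHS]surjective_pairing !raddfMn /= mul0rn; congr pair.
  by apply/eqP; rewrite natr_Zp_eq0 ?pow2_gt1 // dvdn_exp2l.
- move=> [[m y] [/= m1 /(congr1 snd)]].
  rewrite raddfMn raddfB raddfMn /= opprK => /eqP.
  by rewrite mulrn_eq0 expn_eq0 /= => /eqP; lia.
- by move=> [x []].
- by move=> [x []].
- by move=> [x []].
Qed.

Lemma p_divisible_Zpow2 l k : (0 < l)%N ->
  (exists x : 'Z_(2 ^ l), x *+ 2 ^ k = (2 ^ l.-1)%:R) <-> (k < l)%N.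
Proof.
move=> l0; split=> [[x xE]|kl].
  rewrite ltnNge; apply: contraNN (pow2_pred_neq0 l0) => lk.
  rewrite -xE -mulr_natr (_ : (2 ^ k)%:R = 0) ?mulr0 //.
  by rewrite -(subnK lk) expnD natrM pchar_Zp ?pow2_gt1 // mulr0.
exists (2 ^ (l.-1 - k))%:R; rewrite -mulrnA -expnD subnK //.
by rewrite -ltnS prednK.
Qed.

Lemma p_divisible_std i k : p_divisible (std_fp i) k <->
  match i with
  | IQ_lower_minus => (k < 1)%N
  | IQ_upper_minus => true
  | IZLambda l _ => (k < l)%N
  | _ => false
  end.
Proof.
case: i => [||l l1||||l l2].
- by split=> // -[/(_ (1 : int))].
- by split=> // -[/(_ (1 : int))].
- by split=> // -[/(_ ((1, 0) : int * 'Z_(2 ^ l)))].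
- by split=> // -[/(_ ((1, 0) : int * int))].
- by rewrite -(@p_divisible_Zpow2 1 k) //; split=> [[_]|//].
- by split=> // _; split=> //; exists 0; rewrite mul0rn.
- by rewrite -(p_divisible_Zpow2 k (ltnW l2)); split=> [[_]|//].
Qed.

Lemma std_mor_antisym i j :
  fp_mor (std_fp i) (std_fp j) -> fp_mor (std_fp j) (std_fp i) -> i = j.
Proof.
move=> f g.
have H : has_odd_h (std_fp i) <-> has_odd_h (std_fp j).
  by split; exact: has_odd_h_mor.
have T k : odd_torsion (std_fp i) k <-> odd_torsion (std_fp j) k.
  by split; exact: odd_torsion_mor.
have D k : p_divisible (std_fp i) k <-> p_divisible (std_fp j) k.
  by split; exact: p_divisible_mor.
move: H; rewrite !has_odd_h_std.
have {}T k := iff_trans (iff_sym (odd_torsion_std i k))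
  (iff_trans (T k) (odd_torsion_std j k)).
have {}D k := iff_trans (iff_sym (p_divisible_std i k))
  (iff_trans (D k) (p_divisible_std j k)).
(* [T 0] singles out [Q_upper_plus], [D 0] separates [Q_lower_plus] from the parameters with h = 0,
   and [D 1] singles out [Q_lower_minus] among these. What remains is told apart by [T] or [D] at
   the indices themselves. *)
move: (T 0) (D 0) (D 1).
case: i f g T D => [||k k1||||k k2] f g T D;
  case: j f g T D => [||l l1||||l l2] f g T D //=; try by lia.
- have kl : k = l by have := T k; have := T l; lia.
  by move=> *; subst l; congr IZP; exact: bool_irrelevance.
- by have := T k; lia.
- by have := T l; lia.
- by have := D l; lia.
- by have := D k; lia.
- have kl : k = l by have := D k; have := D l; lia.
  by move=> *; subst l; congr IZLambda; exact: bool_irrelevance.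
Qed.

Lemma split_fp_mor (P Q : formParam) (G G' : fgAbGroup)
    (phi : fp_mor (split_fp P G) (split_fp Q G')) :
  exists f : fp_mor P Q, forall x, f x = (phi (x, 0)).1.
Proof.
have [||f fE] := @fp_mor_of P Q (fst \o phi \o @inj_l _ G : {additive _ -> _}).
- by move=> x; rewrite -[RHS](mor_h phi).
- by rewrite /= -[inj_l _ _]/(fp_p (split_fp P G) 1) -mor_p.
by exists f.
Qed.

Lemma std_split_cancel i (G G' : fgAbGroup) :
  fp_iso (split_fp (std_fp i) G) (split_fp (std_fp i) G') -> group_iso G G'.
Proof.
move=> [phi phiB]; have [iE|ni] := classic (i = IZP_infty).
  rewrite {}iE in phi phiB *; have [psi phiK psiK] := additive_inverse phiB.
  (* Reassociating to [int * (int * H)] lets the two copies of [int] be cancelled one after the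
     other. *)
  have assoc (H H' : zmodType)
      (f : {additive (int * int) * H -> (int * int) * H'}) :
      exists F : {additive int * (int * H) -> int * (int * H')}, forall x,
      F x = let y := f ((x.1, x.2.1), x.2.2) in (y.1.1, (y.1.2, y.2)).
    apply: additive_of => x y.
    by rewrite -[X in f X]/((x.1, x.2.1, x.2.2) - (y.1, y.2.1, y.2.2)) raddfB.
  have [F FE] := assoc _ _ phi; have [F' F'E] := assoc _ _ psi.
  have [|F1 /split_cancel_int[f fB]] := split_cancel_int (phi := F);
    last by exists f.
  exists F' => -[m [n g]]; rewrite FE F'E /= -!surjective_pairing.
    by rewrite phiK.
  by rewrite psiK.
have [m mE] := split_fp_mor phi.
have mB : bijective m := std_endo_bijective m ni.
have [|f /additive_inverse[f' fK f'K]] := split_cancel_bijective_component phiB.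
  exact: (eq_bij mB mE).
by exists f', f.
Qed.

Lemma std_split_inj i j (G G' : fgAbGroup) :
  fp_iso (split_fp (std_fp i) G) (split_fp (std_fp j) G') ->
  i = j /\ group_iso G G'.
Proof.
move=> ij; have [[phi _] [psi _]] := (ij, fp_iso_sym ij).
have [[f _] [g _]] := (split_fp_mor phi, split_fp_mor psi).
have E := std_mor_antisym f g; split=> //.
by rewrite -{}E in ij; exact: std_split_cancel ij.
Qed.

Theorem theorem1p4 :
  ((forall i : std_index, indecomposable (std_fp i)) /\
   (forall i j : std_index, i <> j -> ~ fp_iso (std_fp i) (std_fp j)) /\
   (forall P : formParam, indecomposable P ->
      exists i : std_index, fp_iso P (std_fp i)))
  /\
  ((forall P : formParam, exists (Q : formParam) (G : fgAbGroup),
      has_maximal_splitting P Q G) /\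
   (forall (P Q Q' : formParam) (G G' : fgAbGroup),
      has_maximal_splitting P Q G -> has_maximal_splitting P Q' G' ->
      fp_iso Q Q' /\ group_iso G G')).
Proof.
split; [split; [exact: std_indecomposable|split] | split].
- move=> i j ij /[dup] [[f _]] /fp_iso_sym[g _].
  by apply: ij; exact: std_mor_antisym.
- exact: indecomposable_std.
- move=> P; have [i [G PG]] := std_splitting P.
  by exists (std_fp i), G; split=> //; exact: std_indecomposable.
- move=> P Q Q' G G' [PQ /indecomposable_std[i Qi]].
  move=> [PQ' /indecomposable_std[j Q'j]].
  (* Both splittings are transported to standard parameters, where the index and the complement are
     determined. *)
  have [] := @std_split_inj i j G G'.
    apply: fp_iso_trans (split_fp_iso G' Q'j); apply: fp_iso_trans PQ'.
    apply: fp_iso_trans (fp_iso_sym PQ); exact/split_fp_iso/fp_iso_sym.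
  move=> ij; split=> //; rewrite -ij in Q'j.
  exact: fp_iso_trans Qi (fp_iso_sym Q'j).
Qed.
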